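(* Let $0\le k\le n$ be integers, let $\sigma=[p_0,\dots,p_n]\subset\mathbb{R}^n$ be an $n$-dimensional simplex, and let $c\in C^k(\sigma)$ be a real simplicial cochain of degree $k$ on $\sigma$. Then the Whitney form $Wc$ is the unique differential $k$-form $\omega$ on $\sigma$ satisfying the following three conditions (that is, $Wc$ satisfies them, and any smooth $k$-form $\omega$ on $\sigma$ satisfying them equals $Wc$): (1) $\omega$ has affine coefficients; (2) for every $k$-dimensional face $\tau$ of $\sigma$, the pull-back $\iota_\tau^*\omega$ is constant, where $\iota_\tau:\tau\hookrightarrow\sigma$ denotes the inclusion map; (3) $\int_\tau\omega=\langle c,\tau\rangle$ for every $k$-dimensional face $\tau$ of $\sigma$.
   Context: Simplices: a $k$-simplex $\tau=[q_0,\dots,q_k]$ is the convex hull of $k+1$ points in general position (affinely independent) in $\mathbb{R}^n$; every simplex is closed. A $k$-face of $\sigma=[p_0,\dots,p_n]$ is a simplex $[p_{i_0},\dots,p_{i_k}]$ spanned by $k+1$ of the vertices of $\sigma$. Simplices are oriented by the order of their vertices: $-\tau$ is $\tau$ with the opposite orientation, and a permutation of the vertices changes the orientation by the sign of the permutation. Barycentric coordinates: each $q\in\sigma$ is uniquely $q=m_0p_0+\dots+m_np_n$ with $m_i\ge 0$ and $\sum_i m_i=1$; the barycentric coordinate functions are $\nu_i(q)=m_i$, $i=0,\dots,n$. They are affine functions of the coordinates $x^1,\dots,x^n$ of $\mathbb{R}^n$. Cochains: $C^k(\sigma)$ is the real vector space of formal linear combinations $c=\sum_\tau a_\tau\tau^*$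 with $a_\tau\in\mathbb{R}$, where $\tau$ runs over the $k$-faces of $\sigma$ (each with a chosen orientation), $\tau^*$ is the dual of $\tau$, and $(-\tau)^*=-\tau^*$. One writes $\langle c,\tau\rangle=a_\tau$ (so $\langle c,-\tau\rangle=-\langle c,\tau\rangle$). Forms: $\Lambda^k(\sigma)$ is the space of smooth exterior differential $k$-forms on $\sigma$. A form $\omega=\sum_I f_I\,dx^I$, with $I=(i_1<\dots<i_k)$ and $dx^I=dx^{i_1}\wedge\dots\wedge dx^{i_k}$, has affine coefficients if every $f_I$ is an affine function, i.e. of the form $a_1x^1+\dots+a_nx^n+b$ with real constants $a_1,\dots,a_n,b$. A form $\eta\in\Lambda^k(\tau)$ of top degree on a $k$-simplex $\tau$ is called constant if it is a constant multiple of the Euclidean volume element of $\tau$. For $k=0$, integration of a $0$-form (function) over a vertex is evaluation at that vertex. Whitney map: $W:C^k(\sigma)\to\Lambda^k(\sigma)$ is the linear map determined on $\tau=[p_{i_0},\dots,p_{i_k}]$ by $$W\tau^*=k!\sum_{j=0}^k(-1)^j\,\nu_{i_j}\,d\nu_{i_0}\wedge\dots\wedge\widehat{d\nu_{i_j}}\wedge\dots\wedge d\nu_{i_k},$$ where the hat means that the factor is omitted; for $k=0$ this reads $W[p_i]^*=\nu_i$. The form $Wc$ is called the Whitney form of $c$. *)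

(* Defs.v *)
From HB Require Import structures.
From mathcomp Require Import all_boot all_order all_algebra all_fingroup.
From mathcomp Require Import all_classical all_reals all_analysis.
Import Order.TTheory GRing.Theory Num.Theory.
Import numFieldNormedType.Exports.

Set Implicit Arguments.
Unset Strict Implicit.
Unset Printing Implicit Defensive.

Local Open Scope classical_set_scope.
Local Open Scope ring_scope.

Section Simplices.
Variables (R : realType) (n k : nat).
Implicit Type q : 'I_k.+1 -> 'rV[R]_n.

Definition edges q : 'M[R]_(k, n) :=
  \matrix_(i < k) (q (lift ord0 i) - q ord0).

Definition affinely_independent q : Prop := row_free (edges q).

(* [m] is a system of affine weights expressing [x] through the points [q]. *)
Definition affine_weights q (x : 'rV[R]_n) (m : 'rV[R]_k.+1) : Prop :=
  \sum_i m 0 i = 1 /\ x = \sum_i m 0 i *: q i.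

Definition simplex q : set 'rV[R]_n :=
  [set x | exists m : 'rV[R]_k.+1, (forall i, 0 <= m 0 i) /\ affine_weights q x m].

(* Nonnegativity of the weights is not required, so that for the vertices of a
   full-dimensional simplex the barycentric coordinates are defined (as affine
   functions) on all of R^n and can be differentiated on the boundary too. *)
Definition bary q (i : 'I_k.+1) (x : 'rV[R]_n) : R :=
  (get [set m : 'rV[R]_k.+1 | affine_weights q x m]) 0 i.

End Simplices.

Section Forms.
Variables (R : realType) (n : nat).

(* A differential k-form takes a point and k tangent vectors, given as the rows
   of a k x n matrix. *)
Definition diff_form (k : nat) := 'rV[R]_n -> 'M[R]_(k, n) -> R.

Definition multilinear k (f : 'M[R]_(k, n) -> R) : Prop :=
  forall (A B C : 'M[R]_(k, n)) (i : 'I_k) (b c : R),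
    row i A = b *: row i B + c *: row i C ->
    row' i B = row' i A -> row' i C = row' i A ->
    f A = b * f B + c * f C.

Definition alternating_map k (f : 'M[R]_(k, n) -> R) : Prop :=
  forall (A : 'M[R]_(k, n)) (i j : 'I_k),
    i != j -> row i A = row j A -> f A = 0.

Fixpoint continuously_differentiable (m : nat) (f : 'rV[R]_n -> R) : Prop :=
  if m is m'.+1 then
    (forall x, differentiable f x) /\
    forall v, continuously_differentiable m' ('D_v f)
  else continuous f.

(* Smoothness on a closed subset: existence of a smooth extension. *)
Definition smooth_on (S : set 'rV[R]_n) (f : 'rV[R]_n -> R) : Prop :=
  exists g : 'rV[R]_n -> R,
    (forall m, continuously_differentiable m g) /\ forall x, S x -> f x = g x.

Definition smooth_form k (S : set 'rV[R]_n) (w : diff_form k) : Prop :=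
  (forall x, S x -> multilinear (w x) /\ alternating_map (w x)) /\
  forall v, smooth_on S (w^~ v).

(* Exterior product of k covectors, normalised so that
   dx^1 /\ ... /\ dx^n is the volume form of R^n. *)
Definition exterior_product k (a : 'I_k -> 'rV[R]_n -> R) (v : 'M[R]_(k, n)) : R :=
  \det (\matrix_(r, s) a r (row s v)).

Definition increasing k m (I : {ffun 'I_k -> 'I_m}) : bool :=
  [forall i : 'I_k, forall j : 'I_k, (i < j)%N ==> (I i < I j)%N].

Definition dx k (I : {ffun 'I_k -> 'I_n}) : 'M[R]_(k, n) -> R :=
  exterior_product (fun r (u : 'rV[R]_n) => u 0 (I r)).

Definition affine_function (f : 'rV[R]_n -> R) : Prop :=
  exists (a : 'rV[R]_n) (b : R), forall x, f x = \sum_i a 0 i * x 0 i + b.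

Definition affine_coefficients k (S : set 'rV[R]_n) (w : diff_form k) : Prop :=
  exists f : {ffun 'I_k -> 'I_n} -> 'rV[R]_n -> R,
    (forall I, affine_function (f I)) /\
    forall x v, S x -> w x v = \sum_(I | increasing I) f I x * dx I v.

(* If v = A *m edges q, i.e. A holds the coordinates of v in the basis of edges,
   and G = edges q *m (edges q)^T is the Gram matrix (the metric in these
   coordinates), then this is sqrt (det G) * det A. *)
Definition volume_element k (q : 'I_k.+1 -> 'rV[R]_n) (v : 'M[R]_(k, n)) : R :=
  \det (v *m (edges q)^T) / Num.sqrt (\det (edges q *m (edges q)^T)).

(* The pull-back of w along the inclusion of the simplex is w restricted to
   points of the simplex and to vectors tangent to it, that is, to vectors in
   the span of its edges. *)
Definition constant_pullback k (q : 'I_k.+1 -> 'rV[R]_n) (w : diff_form k) : Prop :=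
  exists a : R, forall x v,
    simplex q x -> (v <= edges q)%MS -> w x v = a * volume_element q v.

(* Iterated Lebesgue integral of f over {t | 0 <= t_i, \sum_i t_i <= s}. *)
Fixpoint corner_integral (k : nat) (s : R) : ('rV[R]_k -> R) -> R :=
  match k return ('rV[R]_k -> R) -> R with
  | 0 => fun f => f 0
  | k'.+1 => fun f =>
      \int[lebesgue_measure]_(t in `[0, s])
        corner_integral (s - t)
          (fun u : 'rV[R]_k' => f (row_mx (t%:M : 'rV[R]_1) u))
  end.

(* Integral of the pull-back of w along the parametrisation
   t |-> q_0 + \sum_i t_i (q_i - q_0), whose differential sends the standard
   basis to the edges. *)
Definition integral_form k (q : 'I_k.+1 -> 'rV[R]_n) (w : diff_form k) : R :=
  corner_integral 1 (fun t => w (q ord0 + t *m edges q) (edges q)).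

End Forms.

(* A cochain is given by its values <c, t> on the oriented simplices
   t = [p_(t 0), ..., p_(t k)]; in particular it vanishes on tuples with a
   repeated vertex. *)
Record cochain (R : realType) (n k : nat) := Cochain {
  pairing :> {ffun 'I_k.+1 -> 'I_n.+1} -> R;
  pairing_perm : forall (t : {ffun 'I_k.+1 -> 'I_n.+1}) (s : 'S_k.+1),
    pairing [ffun i => t (s i)] = (-1) ^+ s * pairing t }.

Section Whitney.
Variables (R : realType) (n k : nat) (p : 'I_n.+1 -> 'rV[R]_n).

Definition whitney_dual (t : {ffun 'I_k.+1 -> 'I_n.+1}) : diff_form R n k :=
  fun x v => k`!%:R * \sum_(j < k.+1) (-1) ^+ j * bary p (t j) x *
    exterior_product (fun r => 'd (bary p (t (lift j r))) x) v.

(* The increasing tuples choose one orientation of each k-face, so that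
   c = \sum_t <c, t> t^*. *)
Definition whitney (c : cochain R n k) : diff_form R n k :=
  fun x v => \sum_(t : {ffun 'I_k.+1 -> 'I_n.+1} | increasing t)
    c t * whitney_dual t x v.

End Whitney.

(* Main.v *)
Require Import Defs.
From HB Require Import structures.
From mathcomp Require Import all_boot all_order all_algebra all_fingroup.
From mathcomp Require Import all_classical all_reals all_analysis.
From mathcomp Require Import ring.
Import Order.TTheory GRing.Theory Num.Theory.
Import numFieldNormedType.Exports.
Local Open Scope classical_set_scope.
Local Open Scope ring_scope.

(* In homogeneous coordinates let H be the matrix with rows (1, p_i) and
   N(x, v) = [[1, x], [0, v]] for a point x and k vectors v. The barycentric
   coordinates of x and the differentials applied to v are the rows of
   N(x, v) H^-1, so Laplace expansion along the first row shows that W t^* (x, v)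
   is k! times the minor of N(x, v) H^-1 on the columns t. When x lies on the face
   t and v = A * (edges of t), N(x, v) = B * (rows t of H) with det B = det A;
   hence (W c)(x, v) = k! <c, t> det A, which gives (2) and (3) because the
   standard simplex has volume 1 / k!. For uniqueness, (2) and (3) fix the value of
   the form at each vertex p_j on every k-tuple of edges issuing from p_j. These
   edges form a basis of R^n, so the form is determined at the vertices, and
   therefore everywhere by affine interpolation. *)

Set Implicit Arguments.
Unset Strict Implicit.
Unset Printing Implicit Defensive.

(** * Increasing index tuples, sorting and incidence determinants *)

Section IncreasingTuples.

Lemma increasingP {k m : nat} {I : {ffun 'I_k -> 'I_m}} :
  reflect {homo I : i j / (i < j)%N >-> (i < j)%N} (increasing I).
Proof.
apply: (iffP forallP) => [h i j ij|h i].
  by move/forallP: (h i) => /(_ j)/implyP; apply.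
by apply/forallP => j; apply/implyP/h.
Qed.

Lemma increasing_inj k m (I : {ffun 'I_k -> 'I_m}) : increasing I -> injective I.
Proof.
move=> /increasingP hI i j Iij; apply: val_inj => /=.
by have [/hI|/hI|//] := ltngtP i j; rewrite Iij ltnn.
Qed.

(** If [i] and [s i] differed, monotonicity would make the orbit [i], [s i], [s (s i)], ... strictly
    monotone inside a finite ordinal. Each inequality is an induction along this orbit, on the
    distance to the end it runs towards. *)
Lemma increasing_perm_id k (s : 'S_k) :
  {homo s : i j / (i < j)%N >-> (i < j)%N} -> s = 1%g.
Proof.
move=> hs; apply/permP => i; rewrite perm1; apply/val_inj/anti_leq/andP; split.
- have [m] := ubnP (k - s i)%N; elim: m i => // m IH i; rewrite ltnS => le.
  have [//|lt] := leqP (s i) i.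
  suff: (s (s i) <= s i)%N by rewrite leqNgt hs.
  apply: IH; apply: leq_trans le.
  by rewrite ltn_sub2l // hs.
- have [m] := ubnP i; elim: m i => // m IH i; rewrite ltnS => le.
  have [//|lt] := leqP i (s i).
  suff: (s i <= s (s i))%N by rewrite leqNgt hs.
  by apply: IH; apply: leq_trans le.
Qed.

Lemma increasing_sort k m (t : {ffun 'I_k -> 'I_m}) : injective t ->
  exists s : 'S_k, increasing [ffun i => t (s i)].
Proof.
move=> tinj.
pose T := [tuple t i | i < k].
have Tsz : size (sort <=%O T) == k by rewrite size_sort size_tuple.
have /tuple_permP[s Es] : perm_eq (Tuple Tsz) T by rewrite perm_sort.
exists s; apply/increasingP => i j ij; rewrite !ffunE.
have nthE (l : 'I_k) : nth (t l) (sort <=%O T) l = t (s l).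
  rewrite [sort _ _]Es (nth_map l) ?size_enum_ord // nth_ord_enum.
  by rewrite tnth_mktuple.
have le : (t (s i) <= t (s j))%O.
  rewrite -nthE -(nthE j) (set_nth_default (t i)); last by rewrite (eqP Tsz).
  by apply: (sorted_leq_nth le_trans le_refl _ (sort_le_sorted T));
    rewrite ?inE ?(eqP Tsz) // ltnW.
have: t (s i) != t (s j).
  by rewrite (inj_eq tinj) (inj_eq perm_inj) -val_eqE neq_ltn ij.
by move: le; rewrite leEord -val_eqE ltn_neqAle => -> ->.
Qed.

(* A permutation s contributes to the determinant only if I = J \o s; then s is
   increasing, hence trivial. *)
Lemma det_incidence (R : comPzRingType) k m (I J : {ffun 'I_k -> 'I_m}) :
  increasing I -> increasing J ->
  \det (\matrix_(i, j) (I i == J j)%:R : 'M[R]_k) = (I == J)%:R.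
Proof.
move=> hI hJ; have [<-|IJ] := eqVneq I J.
  rewrite -[RHS](det1 _ k); congr (\det _); apply/matrixP => i j.
  by rewrite !mxE (inj_eq (increasing_inj hI)).
rewrite /determinant big1 // => s _.
case: (boolP [forall i, I i == J (s i)]) => [/forallP h|/forallPn[i ni]].
  have s1 : s = 1%g.
    apply: increasing_perm_id => i j ij; rewrite ltnNge.
    apply/negP; rewrite leq_eqVlt => /orP[/eqP/val_inj/perm_inj e|lt].
      by rewrite e ltnn in ij.
    have /increasingP := hI; move=> /(_ _ _ ij).
    rewrite (eqP (h i)) (eqP (h j)) ltnNge => /negP; apply.
    by move/increasingP: hJ => /(_ _ _ lt)/ltnW.
  case/negP: IJ; apply/eqP/ffunP => i.
  by rewrite (eqP (h i)) s1 perm1.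
by rewrite (bigD1 i) //= !mxE (negPf ni) mul0r mulr0.
Qed.

End IncreasingTuples.

(** * Multilinear alternating maps and their expansion in the [dx I] *)

Section Multilinear.
Context {R : realType} {n : nat}.

Definition covectors k (a : 'I_k -> 'rV[R]_n -> R) : Prop :=
  forall r b c u w, a r (b *: u + c *: w) = b * a r u + c * a r w.

Definition delta_rows k (I : 'I_k -> 'I_n) : 'M[R]_(k, n) :=
  \matrix_(i, j) (I i == j)%:R.

Definition replace_row k (A : 'M[R]_(k, n)) i (u : 'rV[R]_n) : 'M[R]_(k, n) :=
  \matrix_(r, s) if r == i then u 0 s else A r s.

Lemma row_delta_rows k (I : 'I_k -> 'I_n) i :
  row i (delta_rows I) = delta_mx 0 (I i).
Proof. by apply/rowP => j; rewrite !mxE eqxx eq_sym. Qed.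

Lemma row_replace_row k (A : 'M[R]_(k, n)) i u j :
  row j (replace_row A i u) = if j == i then u else row j A.
Proof. by apply/rowP => l; rewrite !mxE; case: ifP; rewrite ?mxE. Qed.

Lemma multilinear_replace_row k (f : 'M[R]_(k, n) -> R) A i b c u w :
  multilinear f ->
  f (replace_row A i (b *: u + c *: w)) =
  b * f (replace_row A i u) + c * f (replace_row A i w).
Proof.
move=> hf; have row'E x : row' i (replace_row A i x) = row' i A.
  by apply/matrixP => r s; rewrite !mxE eq_sym (negPf (neq_lift _ _)).
by apply: (hf _ _ _ i); rewrite ?row'E // !row_replace_row eqxx.
Qed.

Lemma linear_eq0 (g : 'rV[R]_n -> R) :
  (forall b c u w, g (b *: u + c *: w) = b * g u + c * g w) ->
  (forall j, g (delta_mx 0 j) = 0) -> forall u, g u = 0.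
Proof.
move=> lin g0 u; rewrite (row_sum_delta u).
elim/big_rec: _ => [|j y _ IH].
  by have := lin 0 0 0 0; rewrite !scale0r addr0 !mul0r addr0.
by rewrite -[y]scale1r lin g0 IH !mulr0 addr0.
Qed.

(** Reduces identities between multilinear maps to tuples of standard basis vectors. *)
Lemma multilinear_eq0 k (f : 'M[R]_(k, n) -> R) : multilinear f ->
  (forall I : 'I_k -> 'I_n, f (delta_rows I) = 0) -> forall A, f A = 0.
Proof.
move=> hf f0.
(* The rows from [m] on are already basis vectors and only the first [m] are arbitrary; each
   induction step replaces row [m] by basis vectors, by linearity in that row. *)
suff H m : forall A : 'M[R]_(k, n),
    (forall i : 'I_k, (m <= i)%N -> exists j, row i A = delta_mx 0 j) -> f A = 0.
  by move=> A; apply: (H k) => i; rewrite leqNgt ltn_ord.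
elim: m => [A hA|m IH A hA].
  have [I hI] := choice (fun i => hA i (leq0n i)).
  rewrite (_ : A = delta_rows I) //.
  by apply/row_matrixP => i; rewrite row_delta_rows.
have [mk|km] := ltnP m k; last first.
  by apply: IH => i /(leq_trans km); rewrite leqNgt ltn_ord.
pose i0 := Ordinal mk.
have -> : A = replace_row A i0 (row i0 A).
  by apply/row_matrixP => i; rewrite row_replace_row; case: eqP => [->|].
apply: (linear_eq0 (g := fun u => f (replace_row A i0 u))) => [b c u w|j].
  exact: multilinear_replace_row.
apply: IH => i mi; rewrite row_replace_row; case: eqVneq => [_|ne].
  by exists j.
apply: hA; rewrite ltn_neqAle mi andbT eq_sym.
by apply: contra ne => /eqP e; apply/eqP/val_inj.
Qed.

Lemma multilinearZ k (f : 'M[R]_(k, n) -> R) e :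
  multilinear f -> multilinear (fun v => e * f v).
Proof.
move=> hf A B C i b c h1 h2 h3; rewrite (hf _ _ _ _ _ _ h1 h2 h3).
by rewrite mulrDr mulrCA (mulrCA e).
Qed.

Lemma multilinearB k (f g : 'M[R]_(k, n) -> R) :
  multilinear f -> multilinear g -> multilinear (fun v => f v - g v).
Proof.
move=> hf hg A B C i b c h1 h2 h3.
rewrite (hf _ _ _ _ _ _ h1 h2 h3) (hg _ _ _ _ _ _ h1 h2 h3).
by rewrite opprD addrACA !mulrBr.
Qed.

Lemma multilinear_sum k J (r : seq J) (P : pred J) (f : J -> 'M[R]_(k, n) -> R) :
  (forall j, P j -> multilinear (f j)) ->
  multilinear (fun v => \sum_(j <- r | P j) f j v).
Proof.
move=> hf A B C i b c h1 h2 h3; rewrite !mulr_sumr -big_split /=.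
by apply: eq_bigr => j Pj; rewrite (hf j Pj _ _ _ _ _ _ h1 h2 h3).
Qed.

Lemma alternatingZ k (f : 'M[R]_(k, n) -> R) e :
  alternating_map f -> alternating_map (fun v => e * f v).
Proof. by move=> hf A i j ij rij; rewrite (hf _ _ _ ij rij) mulr0. Qed.

Lemma alternating_sum k J (r : seq J) (P : pred J) (f : J -> 'M[R]_(k, n) -> R) :
  (forall j, P j -> alternating_map (f j)) ->
  alternating_map (fun v => \sum_(j <- r | P j) f j v).
Proof.
by move=> hf A i l il ril; rewrite big1 // => j Pj; rewrite (hf j Pj _ _ _ il ril).
Qed.

Lemma exterior_product_multilinear k (a : 'I_k -> 'rV[R]_n -> R) :
  covectors a -> multilinear (exterior_product a).
Proof.
(* The vectors index the columns of the determinant, hence the transposition before using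
   multilinearity in the rows. *)
move=> ha A B C i b c h1 h2 h3; rewrite /exterior_product -!(det_tr (\matrix_(r, s) _)).
have row'E (X Y : 'M[R]_(k, n)) : row' i X = row' i Y ->
    row' i (\matrix_(r, s) a r (row s X))^T = row' i (\matrix_(r, s) a r (row s Y))^T.
  move=> /row_matrixP e; apply/matrixP => s r; rewrite !mxE; congr (a r _).
  by move: (e s); rewrite !row_rowsub.
apply: (determinant_multilinear (i0 := i)); try exact: row'E.
by apply/rowP => r; rewrite !mxE h1 ha.
Qed.

Lemma exterior_product_alternating k (a : 'I_k -> 'rV[R]_n -> R) :
  alternating_map (exterior_product a).
Proof.
move=> A i j ij rij; rewrite /exterior_product -det_tr.
by apply: (determinant_alternate ij) => r; rewrite !mxE rij.
Qed.

Lemma exterior_product_delta_perm k (a : 'I_k -> 'rV[R]_n -> R) I (s : 'S_k) :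
  exterior_product a (delta_rows (I \o s)) =
  (-1) ^+ s * exterior_product a (delta_rows I).
Proof.
rewrite /exterior_product -odd_permV -det_perm mulrC -det_mulmx -col_permE; congr (\det _).
apply/matrixP => r j; rewrite !mxE; congr (a r _).
by apply/rowP => l; rewrite !mxE.
Qed.

Lemma covectors_coord k (I : 'I_k -> 'I_n) :
  covectors (fun r (u : 'rV[R]_n) => u 0 (I r)).
Proof. by move=> r b c u w; rewrite !mxE. Qed.

Lemma dx_delta_rows k (I J : {ffun 'I_k -> 'I_n}) :
  increasing I -> increasing J -> dx I (delta_rows J) = (I == J)%:R :> R.
Proof.
move=> hI hJ; rewrite eq_sym -det_incidence // -det_tr; congr (\det _).
by apply/matrixP => i j; rewrite !mxE.
Qed.

Definition expands_in_dx k (f : 'M[R]_(k, n) -> R) : Prop := forall v,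
  f v = \sum_(I : {ffun 'I_k -> 'I_n} | increasing I) f (delta_rows I) * dx I v.

(** Both sides are multilinear, so basis tuples suffice. A repeated index annihilates both sides;
    otherwise sorting the indices multiplies both by the same sign, and on an increasing tuple the
    [dx I] are dual to the basis tuples. *)
Lemma exterior_product_expand k (a : 'I_k -> 'rV[R]_n -> R) :
  covectors a -> expands_in_dx (exterior_product a).
Proof.
move=> ha v; apply/eqP; rewrite -subr_eq0; apply/eqP; move: v.
apply: multilinear_eq0 => [|I].
  apply: multilinearB; first exact: exterior_product_multilinear.
  apply: multilinear_sum => I _; apply: multilinearZ.
  exact/exterior_product_multilinear/covectors_coord.
case: (boolP (injectiveb I)) => [/injectiveP Iinj|/injectivePn[i [j ij Iij]]]; last first.
  have rij : row i (delta_rows I) = row j (delta_rows I).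
    by rewrite !row_delta_rows Iij.
  rewrite (exterior_product_alternating _ ij rij) big1 ?subr0 // => J _.
  by rewrite [dx _ _](exterior_product_alternating _ ij rij) mulr0.
have finj : injective (finfun I) by move=> i j; rewrite !ffunE => /Iinj.
have [s hs] := increasing_sort finj; set J := [ffun _ => _] in hs.
have -> : delta_rows I = delta_rows (J \o (s^-1)%g).
  by apply/matrixP => i j; rewrite !mxE /= !ffunE permKV.
under eq_bigr do rewrite [dx _ _]exterior_product_delta_perm -/(dx _ _) mulrCA.
rewrite exterior_product_delta_perm -mulr_sumr -mulrBr (bigD1 J) //=.
rewrite dx_delta_rows // eqxx mulr1 big1 ?addr0 ?subrr ?mulr0 // => I' /andP[hI' ne].
by rewrite dx_delta_rows // (negPf ne) mulr0.
Qed.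

Lemma expands_in_dxZ k (f : 'M[R]_(k, n) -> R) e :
  expands_in_dx f -> expands_in_dx (fun v => e * f v).
Proof.
by move=> hf v; rewrite hf mulr_sumr; apply: eq_bigr => I _; rewrite mulrA.
Qed.

Lemma expands_in_dx_sum k J (r : seq J) (P : pred J) (f : J -> 'M[R]_(k, n) -> R) :
  (forall j, P j -> expands_in_dx (f j)) ->
  expands_in_dx (fun v => \sum_(j <- r | P j) f j v).
Proof.
move=> hf v; under [RHS]eq_bigr do rewrite mulr_suml.
by rewrite [RHS]exchange_big; apply: eq_bigr => j Pj; exact: hf.
Qed.

(* By the expansion of A *m E^T (Cauchy-Binet), the Gram determinant is a sum
   of squares. *)
Lemma gram_det_gt0 k (E : 'M[R]_(k, n)) : row_free E -> 0 < \det (E *m E^T).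
Proof.
move=> Efree; rewrite lt_neqAle eq_sym; apply/andP; split.
  (* A kernel vector [u] of the Gram matrix gives [u *m E] squared norm zero, contradicting the
     independence of the rows. *)
  apply/negP => /det0P[u u0 uE].
  have uE0 : u *m E = 0.
    have : (u *m E) *m (u *m E)^T = 0.
      by rewrite trmx_mul mulmxA -(mulmxA u) uE mul0mx.
    move: (u *m E) => y /matrixP/(_ 0 0); rewrite !mxE => /eqP.
    rewrite psumr_eq0 => [/allP h|j _]; last by rewrite !mxE sqr_ge0.
    apply/rowP => j; have /implyP := h j (mem_index_enum j).
    by rewrite !mxE mulf_eq0 orbb => /(_ isT)/eqP.
  case/eqP: u0; apply: (row_free_inj Efree).
  by rewrite uE0 mul0mx.
have -> : \det (E *m E^T) =
    exterior_product (fun r (u : 'rV[R]_n) => (u *m E^T) 0 r) E.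
  rewrite -det_tr; congr (\det _); apply/matrixP => i j.
  by rewrite mxE [RHS]mxE -row_mul [RHS]mxE.
rewrite exterior_product_expand; last first.
  by move=> r b c u w; rewrite mulmxDl -!scalemxAl !mxE.
apply: sumr_ge0 => I _; suff -> : exterior_product
   (fun r (u : 'rV[R]_n) => (u *m E^T) 0 r) (delta_rows I) = dx I E.
  exact: sqr_ge0.
rewrite /dx /exterior_product -det_tr; congr (\det _).
apply/matrixP => i j; rewrite !mxE (bigD1 (I i)) //= !mxE eqxx mul1r.
by rewrite big1 ?addr0 // => l /negPf ne; rewrite !mxE eq_sym ne mul0r.
Qed.

End Multilinear.

(** * Affine functions: differentials, smoothness, affine combinations *)

Section Affine.
Context {R : realType} {n : nat}.

Lemma is_diff_affine (f : 'rV[R]_n -> R) (a : 'rV[R]_n) b x :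
  (forall y, f y = \sum_i a 0 i * y 0 i + b) ->
  is_diff x f (fun u => \sum_i a 0 i * u 0 i : R).
Proof.
move=> fE; pose l (u : 'rV[R]_n) : R := \sum_i a 0 i * u 0 i.
have llin : linear l.
  move=> c u v; rewrite /l scaler_sumr -big_split /=; apply: eq_bigr => i _.
  by rewrite !mxE mulrDr mulrCA.
pose lM := GRing.isLinear.Build R 'rV[R]_n R *:%R l llin.
pose L : {linear 'rV[R]_n -> R} := HB.pack l lM.
have lsum : l = \sum_(i < n) (a 0 i *: (fun u : 'rV[R]_n => u 0 i : R)).
  by apply/funext => u; rewrite fct_sumE.
have Lcont : continuous L.
  move=> u; apply: differentiable_continuous.
  rewrite [X in differentiable X _]lsum; apply: differentiable_sum => i.
  exact/differentiableZ/differentiable_coord.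
have -> : f = (L : 'rV[R]_n -> R) + cst b by apply/funext => y; rewrite fE.
(* The summand [0] is the differential of [cst b]; it gives the goal the shape of a sum of
   differentials. *)
have -> : (fun u : 'rV[R]_n => \sum_i a 0 i * u 0 i) = (L : 'rV[R]_n -> R) + 0.
  by apply/funext => y; rewrite [RHS]addr0.
apply: is_diffD; apply: DiffDef; [exact: linear_differentiable|exact: diff_lin].
Qed.

(** A directional derivative of an affine function is constant, hence affine again, so the induction
    on the order closes. *)
Lemma affine_function_smooth (f : 'rV[R]_n -> R) m :
  affine_function f -> continuously_differentiable m f.
Proof.
elim: m f => [|m IH] f [a [b fE]] /=.
  move=> x; have := is_diff_affine x fE => -[df _].
  exact: differentiable_continuous.
split=> [x|v]; first by have := is_diff_affine x fE => -[].
apply: IH; exists 0, (\sum_i a 0 i * v 0 i) => x.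
have := is_diff_affine x fE => -[df dfE].
rewrite deriveE // dfE [X in _ = X + _]big1 ?add0r // => i _.
by rewrite mxE mul0r.
Qed.

Lemma affine_functionZ c (f : 'rV[R]_n -> R) :
  affine_function f -> affine_function (fun x => c * f x).
Proof.
move=> [a [b fE]]; exists (c *: a), (c * b) => x.
rewrite fE mulrDr mulr_sumr; congr (_ + _); apply: eq_bigr => i _.
by rewrite mxE mulrA.
Qed.

Lemma affine_function_sum J (r : seq J) (P : pred J) (f : J -> 'rV[R]_n -> R) :
  (forall j, P j -> affine_function (f j)) ->
  affine_function (fun x => \sum_(j <- r | P j) f j x).
Proof.
move=> hf; elim: r => [|j r [a [b IH]]].
  by exists 0, 0 => x; rewrite big_nil big1 ?addr0 // => i _; rewrite mxE mul0r.
case: (boolP (P j)) => Pj; last first.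
  by exists a, b => x; rewrite big_cons (negPf Pj).
have [a' [b' fE]] := hf j Pj; exists (a' + a), (b' + b) => x.
rewrite big_cons Pj IH fE addrACA -big_split /=; congr (_ + _).
by apply: eq_bigr => i _; rewrite mxE mulrDl.
Qed.

(** The total weight 1 is what reproduces the constant term. *)
Lemma affine_function_comb (f : 'rV[R]_n -> R) m (l : 'I_m -> R) (q : 'I_m -> 'rV[R]_n) :
  affine_function f -> \sum_i l i = 1 ->
  f (\sum_i l i *: q i) = \sum_i l i * f (q i).
Proof.
move=> [a [b fE]] l1; rewrite fE; under [RHS]eq_bigr do rewrite fE mulrDr.
rewrite big_split /= -mulr_suml l1 mul1r; congr (_ + _).
under eq_bigr do rewrite summxE mulr_sumr.
rewrite exchange_big; apply: eq_bigr => i _; rewrite mulr_sumr.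
by apply: eq_bigr => j _; rewrite mxE mulrCA.
Qed.

End Affine.

(** * Integrals of constants over the standard simplex *)

Section CornerIntegral.
Context {R : realType}.
Local Notation mu := (@lebesgue_measure R).

Lemma Rintegral_power (s c : R) k : 0 <= s ->
  \int[mu]_(t in `[0, s]) (c * (s - t) ^+ k) = c * s ^+ k.+1 / k.+1%:R.
Proof.
(* The fundamental theorem of calculus is applied on a nondegenerate interval, so [s = 0] is treated
   apart. *)
rewrite le_eqVlt => /predU1P[<-|s0].
  by rewrite set_itv1 Rintegral_set1 expr0n /= mulr0 mul0r.
pose F t : R := - (c / k.+1%:R) * (s - t) ^+ k.+1.
have dF (t : R) : is_derive t (1 : R) F (c * (s - t) ^+ k).
  have -> : F = - (c / k.+1%:R) *: ((cst s - id) ^+ k.+1 : R -> R).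
    by apply/funext => y; rewrite /F /= exprfctE.
  apply: is_derive_eq; rewrite sub0r /GRing.scale /=.
  by field; rewrite nat1r pnatr_eq0.
have cF : continuous F.
  by move=> t; apply/differentiable_continuous/derivable1_diffP; have [] := dF t.
rewrite /Rintegral (@continuous_FTC2 _ _ F) //=.
- by rewrite /F subrr expr0n mulr0 sub0r subr0 mulNr opprK mulrAC.
- apply: continuous_subspaceT => t.
  apply: cvgM; first exact: cvg_cst.
  by apply: (@continuous_comp _ _ _ (fun t => s - t) (fun y => y ^+ k));
    [apply: cvgB; [exact: cvg_cst|exact: cvg_id]|exact: exprn_continuous].
- split=> [t _||].
  + by have [] := dF t.
  + exact/cvg_at_right_filter/cF.
  + exact/cvg_at_left_filter/cF.
- by move=> t _; rewrite derive1E; have [] := dF t.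
Qed.

(** Slicing at first coordinate [t] leaves a corner of size [s - t] in one dimension less, so the
    induction integrates a power of [s - t]. At [s = 1] this is the volume [1 / k!]. *)
Lemma corner_integral_cst k (s : R) (f : 'rV[R]_k -> R) C : 0 <= s ->
  (forall u : 'rV[R]_k, (forall i, 0 <= u 0 i) -> \sum_i u 0 i <= s -> f u = C) ->
  corner_integral s f = C * s ^+ k / k`!%:R.
Proof.
elim: k s f => [|k IH] s f s0 fC /=.
  by rewrite divr1 mulr1; apply: fC => [i|]; rewrite ?mxE // big_ord0.
transitivity (\int[mu]_(t in `[0, s]) (C / k`!%:R * (s - t) ^+ k)).
  apply: eq_Rintegral => t; rewrite inE /= in_itv /= => /andP[t0 ts].
  rewrite IH ?subr_ge0 //; first by rewrite mulrAC.
  move=> u u0 us; apply: fC => [i|].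
    by rewrite mxE; case: splitP => j _; rewrite ?mxE // ord1 eqxx.
  rewrite big_ord_recl /=.
  have -> : row_mx t%:M u 0 (ord0 : 'I_(1 + k)) = t.
    by rewrite mxE; case: splitP => j // _; rewrite ord1 mxE eqxx.
  rewrite (eq_bigr (u 0)) => [|i _]; first by rewrite addrC -lerBrDr.
  by rewrite mxE; case: splitP => j; [rewrite ord1|move=> [/val_inj ->]].
rewrite Rintegral_power // factS natrM.
have k0 : k`!%:R != 0 :> R by rewrite pnatr_eq0 -lt0n fact_gt0.
by field; rewrite k0 nat1r pnatr_eq0.
Qed.

End CornerIntegral.

(** * Homogeneous coordinates of points and tangent vectors *)

Section AffineFrames.
Context {R : realType} {n : nat}.

(* Affine weights with respect to q are linear coordinates with respect to the
   rows of this matrix. *)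
Definition homogeneous k (q : 'I_k.+1 -> 'rV[R]_n) : 'M[R]_(1 + k, 1 + n) :=
  row_mx (const_mx 1) (\matrix_i q i).

(** Points get leading entry 1 and vectors leading entry 0. This is the matrix [N(x, v)]. *)
Definition frame k (x : 'rV[R]_n) (v : 'M[R]_(k, n)) : 'M[R]_(1 + k, 1 + n) :=
  block_mx 1%:M x 0 v.

(** Left multiplication turns the list of vertices into the list of edges from vertex 0. *)
Definition difference_mx k : 'M[R]_(k, 1 + k) :=
  \matrix_(i, l) ((lift ord0 i == l)%:R - (ord0 == l)%:R).

Lemma mul_difference_mx k m (Q : 'M[R]_(1 + k, m)) i j :
  (difference_mx k *m Q) i j = Q (lift ord0 i) j - Q ord0 j.
Proof.
have sum1 (a : 'I_(1 + k)) : \sum_l (a == l)%:R * Q l j = Q a j.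
  rewrite (bigD1 a) //= eqxx mul1r big1 ?addr0 // => l.
  by rewrite eq_sym => /negPf ->; rewrite mul0r.
rewrite mxE -!sum1 -sumrB; apply: eq_bigr => l _.
by rewrite mxE mulrBl.
Qed.

Lemma difference_mx_homogeneous k (q : 'I_k.+1 -> 'rV[R]_n) :
  difference_mx k *m homogeneous q = row_mx 0 (edges q).
Proof.
apply/matrixP => i j; rewrite mul_difference_mx !mxE.
by case: splitP => l _; rewrite !mxE ?subrr.
Qed.

Lemma mul_homogeneous k (q : 'I_k.+1 -> 'rV[R]_n) (m : 'rV[R]_k.+1) :
  m *m homogeneous q = row_mx (\sum_i m 0 i)%:M (\sum_i m 0 i *: q i).
Proof.
rewrite mul_mx_row; congr row_mx; apply/rowP => j.
  by rewrite !mxE ord1 eqxx; apply: eq_bigr => i _; rewrite mxE mulr1.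
by rewrite summxE mxE; apply: eq_bigr => i _; rewrite !mxE.
Qed.

Lemma homogeneous_comp k m (q : 'I_m.+1 -> 'rV[R]_n) (t : 'I_k.+1 -> 'I_m.+1) :
  homogeneous (q \o t) = rowsub t (homogeneous q).
Proof.
by apply/matrixP => i j; rewrite !mxE; case: splitP => l _; rewrite !mxE.
Qed.

(** The left factor on the right-hand side depends only on the weights and on [A], not on the
    simplex; it is the matrix [B] of the factorisation on a face. *)
Lemma frame_homogeneous k (q : 'I_k.+1 -> 'rV[R]_n) (m : 'rV[R]_k.+1) (A : 'M[R]_k) :
  \sum_i m 0 i = 1 ->
  frame (\sum_i m 0 i *: q i) (A *m edges q) =
  col_mx m (A *m difference_mx k) *m homogeneous q.
Proof.
move=> m1; rewrite mul_col_mx mul_homogeneous -mulmxA difference_mx_homogeneous.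
by rewrite mul_mx_row mulmx0 m1.
Qed.

Lemma det_frame (x : 'rV[R]_n) (v : 'M[R]_n) : \det (frame x v) = \det v.
Proof. by rewrite /frame det_ublock det1 mul1r. Qed.

End AffineFrames.

(** * Determinants of the coordinate matrices *)

Section Coordinates.
Context {R : realType}.

(** Since the matrix is independent of the simplex, it is evaluated on the standard one, where
    [homogeneous e] is lower unitriangular and the edges form the identity. *)
Lemma det_weights k (m : 'rV[R]_k.+1) (A : 'M[R]_k) :
  \sum_i m 0 i = 1 -> \det (col_mx m (A *m difference_mx k) : 'M[R]_(1 + k)) = \det A.
Proof.
move=> m1.
(* the vertices of the standard simplex *)
pose e (i : 'I_k.+1) : 'rV[R]_k := \row_j (i == lift ord0 j)%:R.
have edges_e : edges e = 1%:M.
  apply/matrixP => i j; rewrite !mxE (inj_eq lift_inj).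
  by rewrite (negPf (neq_lift _ _)) subr0.
have det_e : \det (homogeneous e) = 1.
  have -> : homogeneous e = block_mx 1%:M 0 (const_mx 1) 1%:M.
    rewrite block_mxEh; congr row_mx; apply/matrixP => i j; rewrite !mxE;
      case: splitP => r ir; rewrite !mxE ?ord1 ?eqxx //.
      by rewrite -val_eqE /= ir ord1.
    by rewrite -val_eqE /= ir.
  by rewrite det_lblock !det1 mulr1.
rewrite -[LHS]mulr1 -det_e -det_mulmx -frame_homogeneous //.
by rewrite det_frame edges_e mulmx1.
Qed.

Lemma homogeneous_unit n (p : 'I_n.+1 -> 'rV[R]_n) :
  affinely_independent p -> homogeneous p \in unitmx.
Proof.
rewrite /affinely_independent row_free_unit !unitmxE !unitfE => h.
(* The weights of vertex 0: with [A = 1] the frame consists of [p ord0] and the edges, and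
   [det_weights] gives the left factor determinant 1. *)
pose m : 'rV[R]_n.+1 := delta_mx 0 ord0.
have m1 : \sum_i m 0 i = 1.
  rewrite (bigD1 ord0) //= mxE !eqxx big1 ?addr0 // => i /negPf i0.
  by rewrite mxE i0 andbF.
suff : \det (homogeneous p) = \det (edges p) by move->.
rewrite -[LHS]mul1r -(det1 R n) -(det_weights 1%:M m1) -det_mulmx.
by rewrite -frame_homogeneous // det_frame mul1mx.
Qed.

End Coordinates.

(** * Barycentric coordinates and Whitney forms as minors *)

Section Barycentric.
Context {R : realType} {n : nat} (p : 'I_n.+1 -> 'rV[R]_n).
Hypothesis hp : affinely_independent p.
Local Notation Hinv := (invmx (homogeneous p) : 'M[R]_(1 + n)).

Lemma bary_homogeneous i x :
  bary p i x = (row_mx 1%:M x *m Hinv) 0 i.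
Proof.
have hU := homogeneous_unit hp.
rewrite /bary; set P := [set m | _].
have PE m : P m -> m = row_mx 1%:M x *m Hinv.
  move=> [m1 mx]; apply: (can_inj (mulmxK hU)); rewrite mulmxKV //.
  by rewrite mul_homogeneous m1 -mx.
(* [get] is meaningful only on an inhabited set; the row obtained through the inverse matrix is a
   witness, and [PE] makes it the only one. *)
have : P (get P); last by move/PE ->.
apply: getPex; exists (row_mx 1%:M x *m Hinv).
have := mul_homogeneous p (row_mx 1%:M x *m Hinv).
rewrite mulmxKV // => /eq_row_mx[e1 e2]; split => //.
by move/matrixP: e1 => /(_ 0 0); rewrite !mxE eqxx !mulr1n.
Qed.

Lemma bary_affine i x :
  bary p i x = \sum_a (col i (dsubmx Hinv))^T 0 a * x 0 a + usubmx Hinv 0 i.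
Proof.
rewrite bary_homogeneous -[X in _ *m X]vsubmxK mul_row_col mul1mx mxE addrC.
congr (_ + _); rewrite mxE; apply: eq_bigr => a _.
by rewrite !mxE mulrC.
Qed.

Lemma diff_bary i x u :
  'd (bary p i) x u = (row_mx 0 u *m Hinv) 0 i.
Proof.
have [_ ->] := is_diff_affine x (bary_affine i).
rewrite -[in RHS](vsubmxK Hinv) mul_row_col mul0mx add0r mxE.
by apply: eq_bigr => a _; rewrite !mxE mulrC.
Qed.

Lemma covectors_diff_bary k (s : 'I_k -> 'I_n.+1) x :
  covectors (fun r => 'd (bary p (s r)) x : 'rV[R]_n -> R).
Proof. by move=> r b c u w; rewrite linearD !linearZ. Qed.

Lemma whitney_dual_det k (t : {ffun 'I_k.+1 -> 'I_n.+1}) x v :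
  whitney_dual p t x v =
  k`!%:R * \det (colsub t (frame x v *m Hinv) : 'M[R]_k.+1).
Proof.
congr (_ * _); rewrite (expand_det_row _ ord0); apply: eq_bigr => j _.
have -> : colsub t (frame x v *m Hinv) ord0 j = bary p (t j) x.
  rewrite bary_homogeneous !mxE; apply: eq_bigr => l _; congr (_ * _).
  by rewrite /frame /block_mx mxE; case: splitP => // i _; rewrite ord1.
rewrite (mulrC _ (bary _ _ _)) -mulrA /cofactor add0n; congr (_ * (_ * _)).
(* The cofactor has vectors as rows, the exterior product has them as columns. *)
rewrite -det_tr; congr (\det _).
apply/matrixP => s r; rewrite !mxE diff_bary.
have -> : row_mx (0 : 'M[R]_1) (row r v) = row (lift ord0 r) (frame x v).
  have := rowKd r (row_mx 1%:M x) (row_mx (0 : 'M[R]_(k, 1)) v).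
  by rewrite row_row_mx row0 => <-; congr row; apply: val_inj.
by rewrite -row_mul !mxE.
Qed.

(** Evaluates the expansion of [c] in dual simplices on a face with any vertex order: only the
    increasing rearrangement [t0] contributes, and its determinant carries the same sign as
    [pairing_perm]. *)
Lemma cochain_expand k (c : cochain R n k) (t : {ffun 'I_k.+1 -> 'I_n.+1}) :
  injective t ->
  \sum_(t' | increasing t') c t' *
    \det (\matrix_(i, j) (t i == t' j)%:R : 'M[R]_k.+1) = c t.
Proof.
move=> tinj; have [s] := increasing_sort tinj; set t0 := [ffun _ => _] => ht0.
have tE : t = [ffun i => t0 ((s^-1)%g i)] by apply/ffunP => i; rewrite !ffunE permKV.
rewrite {2}tE pairing_perm.
have detE t' : increasing t' ->
    \det (\matrix_(i, j) (t i == t' j)%:R : 'M[R]_k.+1) =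
    (-1) ^+ (s^-1)%g * (t0 == t')%:R.
  move=> ht'; rewrite -(det_incidence _ ht0 ht') -det_perm -det_mulmx -row_permE.
  by congr (\det _); apply/matrixP => i j; rewrite !mxE ffunE permKV.
rewrite (bigD1 t0) //= detE // eqxx mulr1 mulrC big1 ?addr0 // => t' /andP[ht' ne].
by rewrite detE // eq_sym (negPf ne) !mulr0.
Qed.

Lemma whitney_face k (c : cochain R n k) (t : {ffun 'I_k.+1 -> 'I_n.+1})
    (m : 'rV[R]_k.+1) (A : 'M[R]_k) :
  injective t -> \sum_i m 0 i = 1 ->
  whitney p c (\sum_i m 0 i *: (p \o t) i) (A *m edges (p \o t)) =
  k`!%:R * c t * \det A.
Proof.
move=> tinj m1; rewrite -(cochain_expand c tinj) mulr_sumr mulr_suml.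
apply: eq_bigr => t' _; rewrite whitney_dual_det.
rewrite -[RHS]mulrA [LHS]mulrCA -[in RHS]mulrA; congr (_ * (_ * _)).
rewrite frame_homogeneous // -mulmxA -(det_weights A m1) mulrC -det_mulmx.
congr (\det _); rewrite -mulmx_colsub; congr (_ *m _).
(* The rows [t] of [homogeneous p] times its inverse are rows of the identity, so selecting the
   columns [t'] leaves the incidence matrix of [t] and [t']. *)
rewrite homogeneous_comp.
rewrite mul_rowsub_mx ?mulmxV ?homogeneous_unit //.
by apply/matrixP => i j; rewrite !mxE.
Qed.

Lemma edges_row_free k (t : 'I_k.+1 -> 'I_n.+1) :
  injective t -> row_free (edges (p \o t)).
Proof.
move=> tinj; apply: inj_row_free => y yE.
have : y *m difference_mx k *m rowsub t 1%:M = 0 :> 'rV[R]_(1 + n).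
  rewrite -(mulmxV (homogeneous_unit hp)) -mul_rowsub_mx -homogeneous_comp mulmxA.
  rewrite -(mulmxA y) difference_mx_homogeneous mul_mx_row mulmx0 yE row_mx0.
  exact: mul0mx.
move=> /matrixP e; apply/rowP => i.
(* In barycentric coordinates, the vertex [t (lift ord0 i)] occurs in edge [i] only, so this entry
   of the relation is [y 0 i]. *)
have := e 0 (t (lift ord0 i)); rewrite -mulmxA !mxE (bigD1 i) //= => <-.
rewrite mul_difference_mx !mxE eqxx (inj_eq tinj) (negPf (neq_lift _ _)) subr0 mulr1.
rewrite big1 ?addr0 // => l li.
rewrite mul_difference_mx !mxE !(inj_eq tinj) (inj_eq lift_inj) (negPf li).
by rewrite (negPf (neq_lift _ _)) subrr mulr0.
Qed.

Lemma whitney_alternating k (c : cochain R n k) x :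
  multilinear (whitney p c x) /\ alternating_map (whitney p c x).
Proof.
split.
  apply: multilinear_sum => t _; apply: multilinearZ; apply: multilinearZ.
  apply: multilinear_sum => j _; apply: multilinearZ.
  exact/exterior_product_multilinear/covectors_diff_bary.
apply: alternating_sum => t _; apply: alternatingZ; apply: alternatingZ.
apply: alternating_sum => j _; apply: alternatingZ.
exact: exterior_product_alternating.
Qed.

Lemma whitney_expand k (c : cochain R n k) x : expands_in_dx (whitney p c x).
Proof.
apply: expands_in_dx_sum => t _; do 2!apply: expands_in_dxZ.
apply: expands_in_dx_sum => j _; apply: expands_in_dxZ => v.
exact/exterior_product_expand/covectors_diff_bary.
Qed.

(** The differentials of the barycentric coordinates are constant in [x]; each term therefore
    depends on [x] only through its single undifferentiated factor. *)
Lemma whitney_affine k (c : cochain R n k) v :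
  affine_function (fun x => whitney p c x v).
Proof.
apply: affine_function_sum => t _; apply: affine_functionZ; apply: affine_functionZ.
apply: affine_function_sum => j _.
pose K : R := exterior_product (fun r u => (row_mx 0 u *m Hinv) 0 (t (lift j r))) v.
rewrite (_ : (fun x => _) = fun x => (-1) ^+ j * K * bary p (t j) x).
  apply: affine_functionZ.
  exists (col (t j) (dsubmx Hinv))^T, (usubmx Hinv 0 (t j)) => x.
  exact: bary_affine.
apply/funext => x; rewrite mulrAC; congr (_ * _ * _).
congr (\det _); apply/matrixP => r s; rewrite [LHS]mxE [RHS]mxE.
exact: diff_bary.
Qed.

End Barycentric.

(** * Integration over faces and determination by values at the vertices *)

Section Faces.
Context {R : realType} {n : nat}.

Lemma simplex_vertex k (q : 'I_k.+1 -> 'rV[R]_n) i : simplex q (q i).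
Proof.
exists (delta_mx 0 i); split=> [j|]; first by rewrite mxE ler0n.
split; rewrite (bigD1 i) //= mxE !eqxx ?scale1r big1 ?addr0 // => j /negPf ji;
  by rewrite mxE ji andbF ?scale0r.
Qed.

(** Barycentric weights of the point with parameter [u] in [integral_form]. *)
Definition corner_weights k (u : 'rV[R]_k) : 'rV[R]_k.+1 :=
  row_mx (1 - \sum_i u 0 i)%:M u : 'rV[R]_(1 + k).

Lemma corner_weights0 k (u : 'rV[R]_k) :
  corner_weights u 0 ord0 = 1 - \sum_i u 0 i.
Proof. by rewrite mxE; case: splitP => j // _; rewrite ord1 mxE eqxx. Qed.

Lemma corner_weightsS k (u : 'rV[R]_k) i : corner_weights u 0 (lift ord0 i) = u 0 i.
Proof.
by rewrite mxE; case: splitP => j; [rewrite ord1|move=> [/val_inj ->]].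
Qed.

Lemma sum_corner_weights k (u : 'rV[R]_k) : \sum_i corner_weights u 0 i = 1.
Proof.
rewrite big_ord_recl corner_weights0.
by rewrite [X in _ + X](eq_bigr (u 0)) ?subrK // => i _; rewrite corner_weightsS.
Qed.

Lemma corner_point k (q : 'I_k.+1 -> 'rV[R]_n) (u : 'rV[R]_k) :
  q ord0 + u *m edges q = \sum_i corner_weights u 0 i *: q i.
Proof.
rewrite big_ord_recl corner_weights0 scalerBl scale1r -addrA; congr (_ + _).
rewrite scaler_suml -sumrN -big_split mulmx_sum_row; apply: eq_bigr => i _ /=.
rewrite corner_weightsS addrC -scalerBr; congr (_ *: _).
by apply/rowP => j; rewrite !mxE.
Qed.

Lemma simplex_corner k (q : 'I_k.+1 -> 'rV[R]_n) (u : 'rV[R]_k) :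
  (forall i, 0 <= u 0 i) -> \sum_i u 0 i <= 1 -> simplex q (q ord0 + u *m edges q).
Proof.
move=> u0 u1; exists (corner_weights u); split=> [i|]; last first.
  by split; [exact: sum_corner_weights|exact: corner_point].
case: (unliftP ord0 i) => [j|] ->; first by rewrite corner_weightsS.
by rewrite corner_weights0 subr_ge0.
Qed.

Lemma integral_form_cst k (q : 'I_k.+1 -> 'rV[R]_n) (w : diff_form R n k) C :
  (forall x, simplex q x -> w x (edges q) = C) ->
  integral_form q w = C / k`!%:R.
Proof.
move=> wC; rewrite /integral_form (corner_integral_cst (C := C)) //.
  by rewrite expr1n mulr1.
by move=> u u0 u1; apply/wC/simplex_corner.
Qed.

(** On the edges the form takes one value throughout the simplex, so its integral is that value over
    [k!]. Conditions (2) and (3) thereby become pointwise values, available at the vertices. *)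
Lemma constant_pullback_edges k (q : 'I_k.+1 -> 'rV[R]_n) (w : diff_form R n k) x :
  constant_pullback q w -> simplex q x ->
  w x (edges q) = k`!%:R * integral_form q w.
Proof.
move=> [a wa] qx.
rewrite (integral_form_cst (C := a * volume_element q (edges q))) => [|y qy].
  by rewrite wa // [RHS]mulrCA divff ?mulr1 // pnatr_eq0 -lt0n fact_gt0.
by rewrite wa.
Qed.

Lemma affine_coefficients_comb k m (p : 'I_m.+1 -> 'rV[R]_n) (w : diff_form R n k)
    (l : 'rV[R]_m.+1) v :
  affine_coefficients (simplex p) w -> (forall i, 0 <= l 0 i) -> \sum_i l 0 i = 1 ->
  w (\sum_i l 0 i *: p i) v = \sum_i l 0 i * w (p i) v.
Proof.
move=> [f [f_affine wf]] l0 l1.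
rewrite wf; last by exists l.
have h : affine_function (fun x => \sum_(I | increasing I) f I x * dx I v).
  apply: affine_function_sum => I _; under eq_fun do rewrite mulrC.
  exact: affine_functionZ.
rewrite (affine_function_comb _ h l1).
by apply: eq_bigr => i _; rewrite wf //; exact: simplex_vertex.
Qed.

Lemma multilinear_mulmxr k m (E : 'M[R]_(m, n)) (f : 'M[R]_(k, n) -> R) :
  multilinear f -> multilinear (fun C => f (C *m E)).
Proof.
move=> hf A B C i b c h1 h2 h3; apply: (hf _ _ _ i).
- by rewrite !row_mul h1 mulmxDl -!scalemxAl.
- by rewrite !row'Esub -!mul_rowsub_mx -!row'Esub h2.
- by rewrite !row'Esub -!mul_rowsub_mx -!row'Esub h3.
Qed.

(* The edges issuing from [p j] form a basis of R^n. *)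
Lemma alternating_eq_at_vertex k (p : 'I_n.+1 -> 'rV[R]_n) j
    (f g : 'M[R]_(k, n) -> R) :
  affinely_independent p ->
  multilinear f -> alternating_map f -> multilinear g -> alternating_map g ->
  (forall t : {ffun 'I_k.+1 -> 'I_n.+1}, injective t -> t ord0 = j ->
    f (edges (p \o t)) = g (edges (p \o t))) ->
  forall v, f v = g v.
Proof.
move=> hp fm fa gm ga fg.
(* The face with first vertex [j] whose other vertices are named by [I]; [lift j] skips [j], so
   [spread] keeps injectivity. *)
pose spread m (I : 'I_m -> 'I_n) : {ffun 'I_m.+1 -> 'I_n.+1} :=
  [ffun i => if unlift ord0 i is Some l then lift j (I l) else j].
have spread0 m I : spread m I ord0 = j by rewrite ffunE unlift_none.
have spreadS m I i : spread m I (lift ord0 i) = lift j (I i).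
  by rewrite ffunE liftK.
have spread_inj m I : injective I -> injective (spread m I).
  move=> Iinj a b; case: (unliftP ord0 a) => [a'|] ->;
    case: (unliftP ord0 b) => [b'|] ->; rewrite ?spread0 ?spreadS //.
  - by move/lift_inj/Iinj => ->.
  - by move/eqP; rewrite eq_sym (negPf (neq_lift _ _)).
  - by move/eqP; rewrite (negPf (neq_lift _ _)).
pose E := edges (p \o spread n id).
have Eunit : E \in unitmx.
  by rewrite -row_free_unit; apply: edges_row_free => //; exact: spread_inj.
(* In the basis [E] of all edges from [p j], the edges of such a face form a basis tuple, so
   [multilinear_eq0] applies after the change of basis. *)
have edgesE I : edges (p \o spread k I) = delta_rows I *m E.
  apply/row_matrixP => i; rewrite row_mul row_delta_rows -rowE.
  by apply/rowP => l; rewrite !mxE /= !spread0 !spreadS.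
move=> v; rewrite -(mulmxKV Eunit v); move: (v *m _) => C.
apply/eqP; rewrite -subr_eq0; apply/eqP; move: C.
apply: multilinear_eq0 => [|I].
  by apply: multilinearB; exact: multilinear_mulmxr.
case: (boolP (injectiveb I)) => [/injectiveP Iinj|/injectivePn[a [b ab Iab]]].
  by rewrite -edgesE fg ?subrr //; exact: spread_inj.
have rab : row a (delta_rows I *m E) = row b (delta_rows I *m E).
  by rewrite !row_mul !row_delta_rows Iab.
by rewrite (fa _ _ _ ab rab) (ga _ _ _ ab rab) subrr.
Qed.

End Faces.

(** * Existence and uniqueness of the Whitney form *)

Unset Implicit Arguments.

Theorem mainTheorem1 (R : realType) (n k : nat) (hkn : (k <= n)%N)
    (p : 'I_n.+1 -> 'rV[R]_n) (hp : affinely_independent p)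
    (c : cochain R n k) :
  let characterization (w : diff_form R n k) : Prop :=
    [/\ smooth_form (simplex p) w,
        affine_coefficients (simplex p) w,
        forall t : {ffun 'I_k.+1 -> 'I_n.+1}, injective t ->
          constant_pullback (p \o t) w
      & forall t : {ffun 'I_k.+1 -> 'I_n.+1}, injective t ->
          integral_form (p \o t) w = c t] in
  characterization (whitney p c) /\
  forall w : diff_form R n k, characterization w ->
    forall x v, simplex p x -> w x v = whitney p c x v.
Proof.
move=> characterization.
have face_value (t : {ffun 'I_k.+1 -> 'I_n.+1}) x A :
    injective t -> simplex (p \o t) x ->
    whitney p c x (A *m edges (p \o t)) = k`!%:R * c t * \det A.
  by move=> tinj [m [_ [m1 ->]]]; exact: whitney_face.
have whitneyP : characterization (whitney p c).
  split.
  - split=> [x _|v]; first exact: whitney_alternating.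
    exists (fun x => whitney p c x v); split=> // m.
    exact/affine_function_smooth/whitney_affine.
  - exists (fun I x => whitney p c x (delta_rows I)); split=> [I|x v _].
      exact: whitney_affine.
    exact: whitney_expand.
  - move=> t tinj; have tfree := edges_row_free hp tinj.
    have gram0 := gram_det_gt0 tfree.
    (* On [A *m edges (p \o t)] the volume element equals [\det A] times the square root of the Gram
       determinant, hence the division by this root. *)
    exists (k`!%:R * c t / Num.sqrt (\det (edges (p \o t) *m (edges (p \o t))^T))).
    move=> x v tx /submxP[A ->]; rewrite face_value // /volume_element.
    rewrite -mulmxA det_mulmx -!mulrA; congr (_ * (_ * _)).
    rewrite mulrCA -[LHS]mulr1; congr (_ * _).
    rewrite -[X in _ = _ * (X * _)]sqr_sqrtr ?ltW // expr2 mulfK ?mulVf //;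
      by rewrite gt_eqF // sqrtr_gt0.
  - move=> t tinj; rewrite (integral_form_cst (C := k`!%:R * c t)) => [|x tx].
      by rewrite mulrAC divff ?mul1r // pnatr_eq0 -lt0n fact_gt0.
    by rewrite -[edges _]mul1mx face_value // det1 mulr1.
split=> // w [w_smooth w_affine w_cst w_int] x v [m [m0 [m1 ->]]].
have [_ W_affine W_cst W_int] := whitneyP.
(* Both forms interpolate affinely between the vertices, which leaves a comparison at each [p j]. *)
rewrite !(affine_coefficients_comb _ _ m0 m1) //; apply: eq_bigr => j _; congr (_ * _).
have [w_mul w_alt] := w_smooth.1 _ (simplex_vertex p j).
have [W_mul W_alt] := whitney_alternating p c (p j).
apply: (alternating_eq_at_vertex (j := j) hp) => // t tinj t0.
have tj : simplex (p \o t) (p j) by rewrite -t0; exact: (simplex_vertex (p \o t)).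
(* On the edges of a face starting at [p j], both forms take the value [k!] times [c t]. *)
rewrite (constant_pullback_edges (w_cst t tinj) tj).
by rewrite (constant_pullback_edges (W_cst t tinj) tj) w_int // W_int.
Qed.
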